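(* Let $T$, $\widehat T$, $D$ and $\widehat{\mathcal L}$ be as described in the context. If $\widehat{\mathcal L}$ is $D$-normal, then for every $r\in\mathbb N$ the $\Delta_r$-normal subspace $M_{3,r}(\widehat{\mathcal L}_r)\subset M_3[\mathbb C]$ is of type (T2).
   Context: Notation. $\mathbb N=\{1,2,\dots\}$, $\mathbb C_0=\mathbb C\setminus\{0\}$. $\mathcal L(\mathcal K)$ is the algebra of bounded linear operators on a Hilbert space $\mathcal K$; $\{T\}'$ is the commutant of $T$; $\sigma_{\rm p}$ denotes point spectrum, $\sigma$ spectrum, $\rho(B)=\mathbb C\setminus\sigma(B)$. $\mathcal H$ is a complex Hilbert space with a fixed orthonormal basis $\{e_k\}_{k=1}^\infty$, $\mathcal H^{(3)}=\mathcal H\oplus\mathcal H\oplus\mathcal H$, $e_k\otimes e_k$ is the orthogonal projection onto $\mathbb C e_k$, and $S\in\mathcal L(\mathcal H)$ is the unilateral shift $Se_k=e_{k+1}$ ($k\in\mathbb N$). Setting. $\mathcal H_1,\mathcal H_2$ are complex Hilbert spaces of dimension $\aleph_0$ and $T=\begin{bmatrix}A&C\\ 0&B\end{bmatrix}\in\mathcal L(\mathcal H_1\oplus\mathcal H_2)$, where $A$ is similar to $S$, $\sigma_{\rm p}(T^* )=\emptyset$, and $\{T\}'x$ is dense in $\mathcal H_1\oplus\mathcal H_2$ for every nonzero $x\in\mathcal H_1$ ($\equiv\mathcal H_1\oplus\{0\}$). Fix $b_0\in\partial\sigma(B)$. $T-b_0I$ is similar to an operator $\widehat T\in\mathcal L(\mathcal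 H^{(3)})$ of the form $$\widehat T=\begin{bmatrix} S-b_0I&*&* \\ 0&*&* \\ 0&F_*&D_* \end{bmatrix},$$ where $D_*=\sum_{k=1}^\infty(b_k-b_0)e_k\otimes e_k$, $\rho(B)\ni b_k\to b_0$ (fast enough for such a similarity model to be constructed), $\{b_k\}_{k=1}^\infty$ are distinct nonzero complex numbers, and $\operatorname{rank}F_*\le1$. Let $$\widehat{\mathcal L}=\{Q_{3,1}:[Q_{i,j}]_3\in\{\widehat T\}'\}\subset\mathcal L(\mathcal H),\qquad D=D_*+b_0I=\sum_{k=1}^\infty b_k\,e_k\otimes e_k .$$ $\widehat{\mathcal L}$ is transitive (i.e. $\widehat{\mathcal L}x$ is dense in $\mathcal H$ for every nonzero $x\in\mathcal H$) and $\operatorname{rank}(D\widehat X-\widehat XS)\le1$ for every $\widehat X\in\widehat{\mathcal L}$. Cross-sections. For $r\in\mathbb N$ let $\mathcal E_{3,r}$ be the span of $e_r,e_{r+1},e_{r+2}$; $\widehat{\mathcal L}_r\subset\mathcal L(\mathcal E_{3,r})$ is the set of compressions $P_{\mathcal E_{3,r}}\widehat X|_{\mathcal E_{3,r}}$, $\widehat X\in\widehat{\mathcal L}$, with $P_{\mathcal E_{3,r}}$ the orthogonal projection onto $\mathcal E_{3,r}$; $M_{3,r}:\mathcal L(\mathcal E_{3,r})\to M_3[\mathbb C]$ assigns to an operator its matrix in the basis $(e_r,e_{r+1},e_{r+2})$; and $\Delta_r=\operatorname{diag}(b_r,b_{r+1},b_{r+2})$. $\Delta$-normality. Let $\Delta=\operatorname{diag}(b_1,b_2,b_3)$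 with (arbitrary) distinct $b_1,b_2,b_3\in\mathbb C_0$, and put $b_\Delta(1)=\frac1{b_3}-\frac1{b_2}$, $b_\Delta(2)=\frac1{b_3}-\frac1{b_1}$, $b_\Delta(3)=\frac1{b_2}-\frac1{b_1}$. A subspace $\mathcal L\subset M_3[\mathbb C]$ is $\Delta$-normal if $\dim\mathcal L=5$ and $\mathcal L$ has a basis $(L_1,L_2,Q_1,Q_2,Q_3)$ of the form (T1) or (T2). In both types $$L_1=\begin{bmatrix} 1&0&0 \\ x&0&0 \\ y&0&0 \end{bmatrix},\qquad L_2=\begin{bmatrix} 0&1&0 \\ b_\Delta(3)x&x&0 \\ b_\Delta(2)y&y&0 \end{bmatrix}.$$ Type (T1), with parameters $x,y\in\mathbb C_0$: $$Q_1=\begin{bmatrix} 0&0&1 \\ 0&0&0 \\ 0&0&0 \end{bmatrix},\quad Q_2=\begin{bmatrix} 0&0&0 \\ b_\Delta(3)/b_2&b_\Delta(3)&1 \\ 0&0&0 \end{bmatrix},\quad Q_3=\begin{bmatrix} 0&0&0 \\ 0&0&0 \\ b_\Delta(2)/b_3&b_\Delta(2)&1 \end{bmatrix}.$$ Type (T2), with parameters $x,y,q\in\mathbb C_0$ and $q'\in\mathbb C$: $$Q_1=\begin{bmatrix} 0&0&1 \\ q'&q&0 \\ q'y/x+b_\Delta(1)qy/x&qy/x&0 \end{bmatrix},\quad Q_2=\begin{bmatrix} 0&0&0 \\ b_\Delta(3)/b_2-q'/x&b_\Delta(3)-q/x&1 \\ 0&0&0 \end{bmatrix},$$ $$Q_3=\begin{bmatrix}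 0&0&0 \\ 0&0&0 \\ b_\Delta(2)/b_3-b_\Delta(1)q/x-q'/x&b_\Delta(2)-q/x&1 \end{bmatrix}.$$ $\widehat{\mathcal L}$ is called $D$-normal if $M_{3,r}(\widehat{\mathcal L}_r)$ is $\Delta_r$-normal for every $r\in\mathbb N$ (the formulas above being used with $(b_r,b_{r+1},b_{r+2})$ in place of $(b_1,b_2,b_3)$). *)

(* Defs.v *)
From HB Require Import structures.
From mathcomp Require Import all_boot all_order all_algebra.
From mathcomp Require Import sesquilinear complex.
From mathcomp Require Import all_classical all_reals all_analysis.

Set Implicit Arguments.
Unset Strict Implicit.
Unset Printing Implicit Defensive.

Import Order.TTheory GRing.Theory Num.Theory.
Import numFieldNormedType.Exports.

Local Open Scope classical_set_scope.
Local Open Scope complex_scope.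
Local Open Scope ring_scope.

(* A complex Hilbert space is a Banach space over R[i] whose norm comes from an
   inner product, linear in its first argument. *)
HB.mixin Record CompleteNormedModule_isHilbert (R : realType) V
    of CompleteNormedModule R[i] V := {
  hdot : {dot V for @Num.conj R[i]};
  hdotE : forall x : V, hdot x x = `|x| ^+ 2 }.

#[short(type="hilbertType")]
HB.structure Definition Hilbert (R : realType) :=
  {V of CompleteNormedModule R[i] V & CompleteNormedModule_isHilbert R V}.

(* R[i] is given the topology of its modulus through the alias R[i]^o. *)
Section operators.
Context {R : realType}.
Implicit Types U V : normedModType R[i].

Definition bounded_op {U V} : set (U -> V) :=
  [set f | linear f /\ continuous f].

Definition invertible_op {U V} (f : U -> V) :=
  exists g : V -> U, [/\ bounded_op g, cancel f g & cancel g f].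

Definition similar_op {U V} (T : U -> U) (T' : V -> V) :=
  exists W : U -> V,
    [/\ bounded_op W, invertible_op W & W \o T = T' \o W].

Definition commutant {U} (T : U -> U) : set (U -> U) :=
  [set Q | bounded_op Q /\ Q \o T = T \o Q].

Definition sub_scalar_op {U} (T : U -> U) (a : R[i]) : U -> U :=
  fun x => T x - a *: x.

Definition spectrum {U} (T : U -> U) : set R[i]^o :=
  [set a | ~ invertible_op (sub_scalar_op T a)].

Definition resolvent {U} (T : U -> U) : set R[i]^o := ~` spectrum T.

Definition point_spectrum {U} (T : U -> U) : set R[i] :=
  [set a | exists2 x : U, x != 0 & T x = a *: x].

Definition rank_le1 {U V} (F : U -> V) :=
  exists v : V, forall x, exists c : R[i], F x = c *: v.

Definition transitive_ops {U V} (L : set (U -> V)) :=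
  forall x : U, x != 0 -> dense [set X x | X in L].

Definition boundary {X : topologicalType} (A : set X) : set X :=
  closure A `\` interior A.

End operators.

Section hilbert.
Context {R : realType}.
Implicit Types H : hilbertType R.

(* Bases are indexed from 0: e k is the (k+1)-st basis vector. *)
Definition orthonormal_basis {H} (e : nat -> H) :=
  (forall i j, hdot (e i) (e j) = (i == j)%:R) /\
  dense [set x | exists n (c : nat -> R[i]), x = \sum_(i < n) c i *: e i].

Definition aleph0_dim H := exists e : nat -> H, orthonormal_basis e.

Definition is_unilateral_shift {H} (e : nat -> H) (S : H -> H) :=
  bounded_op S /\ forall k, S (e k) = e k.+1.

(* D = \sum_k d_k e_k \otimes e_k, in the strong operator topology *)
Definition is_diagonal_op {H} (e : nat -> H) (d : nat -> R[i]) (D : H -> H) :=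
  bounded_op D /\
  forall x, series (fun k => (d k * hdot x (e k)) *: e k) @ \oo --> D x.

(* The library norm on H1 * H2 is the sup norm. It is equivalent to the Hilbert
   norm of the direct sum, hence yields the same bounded operators and the same
   dense sets; only adjoints need the inner product of the direct sum. *)
Definition dsum_dot {H1 H2 : hilbertType R} (x y : H1 * H2) : R[i] :=
  hdot x.1 y.1 + hdot x.2 y.2.

Definition is_dsum_adjoint {H1 H2 : hilbertType R}
    (T T' : H1 * H2 -> H1 * H2) :=
  bounded_op T' /\ forall x y, dsum_dot (T x) y = dsum_dot x (T' y).

Definition upper_block {H1 H2 : hilbertType R}
    (A : H1 -> H1) (C : H2 -> H1) (B : H2 -> H2) : H1 * H2 -> H1 * H2 :=
  fun x => (A x.1 + C x.2, B x.2).

Definition inj3 {H} (j : 'I_3) (x : H) : H * H * H :=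
  match val j with 0%N => (x, 0, 0) | 1%N => (0, x, 0) | _ => (0, 0, x) end.

Definition proj3 {H} (i : 'I_3) (z : H * H * H) : H :=
  match val i with 0%N => z.1.1 | 1%N => z.1.2 | _ => z.2 end.

(* Indices start from 0: block3 Q 2 0 is the entry Q_{3,1}. *)
Definition block3 {H} (Q : H * H * H -> H * H * H) (i j : 'I_3) : H -> H :=
  fun x => proj3 i (Q (inj3 j x)).

(* If That has first block column (S - b0, 0, 0) and last block row (0, F, D - b0)
   with rank F <= 1, then the (3,1) entry of Q That = That Q reads
   X S - D X = F Q_{2,1}, so that rank (D X - X S) <= 1 for every X = Q_{3,1} in
   Lhat That. *)
Definition Lhat {H} (That : H * H * H -> H * H * H) : set (H -> H) :=
  [set block3 Q 2 0 | Q in commutant That].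

Definition proj_E3 {H} (e : nat -> H) (r : nat) (x : H) : H :=
  \sum_(i < 3) hdot x (e (r + i)%N) *: e (r + i)%N.

(* matrices, in the basis (e_r, e_{r+1}, e_{r+2}), of the compressions of
   elements of L to the span of these three vectors *)
Definition cross_section_mx {H} (e : nat -> H) (L : set (H -> H)) (r : nat) :
    set 'M[R[i]]_3 :=
  [set M | exists2 X, L X & forall j : 'I_3,
    proj_E3 e r (X (e (r + j)%N)) = \sum_(i < 3) M i j *: e (r + i)%N].

End hilbert.

Section delta_normal.
Context {K : fieldType}.

Definition mx3 (rows : seq (seq K)) : 'M[K]_3 :=
  \matrix_(i < 3, j < 3) nth 0 (nth [::] rows i) j.

Variables b1 b2 b3 : K.

Definition b_Delta1 := b3^-1 - b2^-1.
Definition b_Delta2 := b3^-1 - b1^-1.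
Definition b_Delta3 := b2^-1 - b1^-1.

Definition L1_mx (x y : K) := mx3
  [:: [:: 1; 0; 0];
      [:: x; 0; 0];
      [:: y; 0; 0]].

Definition L2_mx (x y : K) := mx3
  [:: [:: 0; 1; 0];
      [:: b_Delta3 * x; x; 0];
      [:: b_Delta2 * y; y; 0]].

Definition Q1_T1 := mx3
  [:: [:: 0; 0; 1];
      [:: 0; 0; 0];
      [:: 0; 0; 0]].

Definition Q2_T1 := mx3
  [:: [:: 0; 0; 0];
      [:: b_Delta3 / b2; b_Delta3; 1];
      [:: 0; 0; 0]].

Definition Q3_T1 := mx3
  [:: [:: 0; 0; 0];
      [:: 0; 0; 0];
      [:: b_Delta2 / b3; b_Delta2; 1]].

Definition Q1_T2 (x y q q' : K) := mx3
  [:: [:: 0; 0; 1];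
      [:: q'; q; 0];
      [:: q' * y / x + b_Delta1 * q * y / x; q * y / x; 0]].

Definition Q2_T2 (x q q' : K) := mx3
  [:: [:: 0; 0; 0];
      [:: b_Delta3 / b2 - q' / x; b_Delta3 - q / x; 1];
      [:: 0; 0; 0]].

Definition Q3_T2 (x q q' : K) := mx3
  [:: [:: 0; 0; 0];
      [:: 0; 0; 0];
      [:: b_Delta2 / b3 - b_Delta1 * q / x - q' / x; b_Delta2 - q / x; 1]].

Definition has_T1_basis (U : {vspace 'M[K]_3}) :=
  exists x y : K, [/\ x != 0, y != 0 &
    basis_of U [:: L1_mx x y; L2_mx x y; Q1_T1; Q2_T1; Q3_T1]].

Definition has_T2_basis (U : {vspace 'M[K]_3}) :=
  exists x y q q' : K, [/\ x != 0, y != 0, q != 0 &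
    basis_of U [:: L1_mx x y; L2_mx x y;
                   Q1_T2 x y q q'; Q2_T2 x q q'; Q3_T2 x q q']].

Definition delta_normal (L : set 'M[K]_3) :=
  exists U : {vspace 'M[K]_3},
    [/\ L = [set M | M \in U], \dim U = 5 & has_T1_basis U \/ has_T2_basis U].

Definition delta_normal_T2 (L : set 'M[K]_3) :=
  exists U : {vspace 'M[K]_3},
    [/\ L = [set M | M \in U], \dim U = 5 & has_T2_basis U].

End delta_normal.

Definition D_normal {R : realType} {H : hilbertType R} (e : nat -> H)
    (b : nat -> R[i]) (L : set (H -> H)) :=
  forall r, delta_normal (b r) (b r.+1) (b r.+2) (cross_section_mx e L r).

(* Main.v *)
Require Import Defs.
From mathcomp Require Import all_boot all_order all_algebra.
From mathcomp Require Import sesquilinear complex.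
From mathcomp Require Import all_classical all_reals all_analysis.
From mathcomp Require Import ring.

Import Order.TTheory GRing.Theory Num.Theory.
Import numFieldNormedType.Exports.

Local Open Scope classical_set_scope.
Local Open Scope complex_scope.
Local Open Scope ring_scope.

(** The rank condition on [D X - X S] already excludes type (T1).

    Write [x_ij] for the entries [hdot (X (e j)) (e i)] of an operator [X] in
    [Lhat That]. The (3,1) entry of [Q That = That Q] reads
    [X S - D X = F Q_21], where [F] has rank at most one, hence takes its values
    in a line [C v]; since [S] shifts columns and [D] is diagonal this says
    [x_(i,j+1) - b_i x_ij = c_j v_i] ([Lhat_displacement]). All 2 x 2 minors of
    this array of displacements vanish. The minors on the columns [r], [r+1] only
    involve the columns [r], [r+1], [r+2] of [X], so they are visible in the
    cross-section at [r] ([cross_section_minor]).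

    A space of type (T1) contains [L_1 + Q_1], with rows [(1,0,1)], [(x,0,0)],
    [(y,0,0)]. Its displacements on the first two rows are [(-b_r, 1)] and
    [(-b_(r+1) x, 0)], of determinant [b_(r+1) x <> 0]: this matrix is the
    cross-section of no element of [Lhat That], and only (T2) is left
    ([cross_section_not_T1]). *)

Section entries.
Set Implicit Arguments.
Unset Strict Implicit.
Context {R : realType} {H : hilbertType R}.
Implicit Types (e : nat -> H) (x u v : H).

(** These specializations of the rules for sesquilinear forms have [hdot] itself
    as the head of their left-hand sides, which is what rewriting matches. *)
Lemma hdotDl x y u : hdot (x + y) u = hdot x u + hdot y u.
Proof. exact: linearDl. Qed.

Lemma hdotBl x y u : hdot (x - y) u = hdot x u - hdot y u.
Proof. exact: linearBl. Qed.

Lemma hdotZl (a : R[i]) x u : hdot (a *: x) u = a * hdot x u.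
Proof. exact: linearZl_LR. Qed.

Lemma hdotZr (a : R[i]) x u : hdot u (a *: x) = a^* * hdot u x.
Proof. exact: linearZr_LR. Qed.

Lemma hdot_suml (I : Type) (s : seq I) (P : pred I) (F : I -> H) u :
  hdot (\sum_(i <- s | P i) F i) u = \sum_(i <- s | P i) hdot (F i) u.
Proof. exact: linear_sumlz. Qed.

(** Pythagoras for the component of [x] along [u] and its remainder. *)
Lemma norm_hdot_unit_le x u : hdot u u = 1 -> `|hdot x u| <= `|x|.
Proof.
move=> u1; set a := hdot x u; set w := x - a *: u.
have wu : hdot w u = 0 by rewrite hdotBl hdotZl u1 mulr1 subrr.
have wau : hdot w (a *: u) = 0 by rewrite hdotZr wu mulr0.
rewrite -(@ler_pXn2r _ 2) ?nnegrE//.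
have -> : `|x| ^+ 2 = `|w| ^+ 2 + `|a| ^+ 2.
  have pyth : hdot (w + a *: u) (w + a *: u)
      = hdot w w + hdot (a *: u) (a *: u) by exact: hnormDd.
  rewrite -!hdotE -[x in LHS](subrK (a *: u)) pyth.
  by rewrite hdotZl hdotZr u1 mulr1 normCK.
by rewrite lerDr exprn_ge0.
Qed.

(** The partial sums of the series of [D x] have a constant [e i] coordinate
    from rank [i+1] on, and taking this coordinate is 1-Lipschitz. *)
Lemma hdot_diagonal_op e d (D : H -> H) x i :
  orthonormal_basis e -> is_diagonal_op e d D ->
  hdot (D x) (e i) = d i * hdot x (e i).
Proof.
move=> [eo _] [_ /(_ x) Dx]; apply/eqP; rewrite -subr_eq0; apply/negPn/negP.
rewrite -normr_gt0 => eps0.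
(* a discrepancy between the coordinates bounds from below the distance from
   [D x] to every late partial sum, so it can serve as the epsilon *)
move/cvgrPdist_lt: Dx => /(_ _ eps0) [N _ NP].
have /NP /= : (N <= maxn N i.+1)%N by exact: leq_maxl.
set n := maxn _ _; rewrite /series /= => lt_eps.
have partial : hdot (\sum_(0 <= k < n) (d k * hdot x (e k)) *: e k) (e i)
    = d i * hdot x (e i).
  have ltin : (i < n)%N by exact: leq_maxr.
  rewrite hdot_suml big_mkord (bigD1 (Ordinal ltin))//= hdotZl eo eqxx mulr1.
  rewrite big1 ?addr0// => k ki; rewrite hdotZl eo.
  by rewrite (negPf (_ : nat_of_ord k != i)) ?mulr0.
have unit_ei : hdot (e i) (e i) = 1 by rewrite eo eqxx.
have := norm_hdot_unit_le (D x - \sum_(0 <= k < n) (d k * hdot x (e k)) *: e k)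
  unit_ei.
rewrite hdotBl partial => /le_lt_trans/(_ lt_eps).
by rewrite ltxx.
Qed.

Lemma cross_section_entry e (X : H -> H) r (M : 'M[R[i]]_3) (i j : 'I_3) :
  orthonormal_basis e ->
  proj_E3 e r (X (e (r + j)%N)) = \sum_(k < 3) M k j *: e (r + k)%N ->
  hdot (X (e (r + j)%N)) (e (r + i)%N) = M i j.
Proof.
move=> [eo _] /(congr1 (fun y => hdot y (e (r + i)%N))).
have coef (c : 'I_3 -> R[i]) :
    hdot (\sum_(k < 3) c k *: e (r + k)%N) (e (r + i)%N) = c i.
  rewrite hdot_suml (bigD1 i)//= hdotZl eo eqxx mulr1 big1 ?addr0// => k ki.
  by rewrite hdotZl eo eqn_add2l (negPf (_ : nat_of_ord k != i)) ?mulr0.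
by rewrite /proj_E3 !coef.
Qed.

End entries.

Lemma bounded_opD {R : realType} {U V : normedModType R[i]} {f : U -> V} :
  bounded_op f -> {morph f : x y / x + y}.
Proof. by move=> [lf _] x y; have := lf 1 x y; rewrite !scale1r. Qed.

Section intertwining.
Set Implicit Arguments.
Unset Strict Implicit.
Context {R : realType} {H : hilbertType R}.
Variables (e : nat -> H) (S Dstar : H -> H) (b0 : R[i]) (b : nat -> R[i]).
Variable That : H * H * H -> H * H * H.
Hypotheses (e_basis : orthonormal_basis e) (S_shift : is_unilateral_shift e S)
  (Dstar_diagonal : is_diagonal_op e (fun k => b k - b0) Dstar)
  (That_bounded : bounded_op That)
  (That_11 : block3 That 0 0 = sub_scalar_op S b0)
  (That_21 : block3 That 1 0 = 0) (That_31 : block3 That 2 0 = 0)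
  (That_32 : rank_le1 (block3 That 2 1))
  (That_33 : block3 That 2 2 = Dstar).

Lemma That_inj1 x : That (x, 0, 0) = (sub_scalar_op S b0 x, 0, 0).
Proof.
rewrite -That_11; move: (congr1 (@^~ x) That_21) (congr1 (@^~ x) That_31).
by rewrite /block3 /proj3 /inj3 /=; case: (That _) => -[? ?] ? /= -> ->.
Qed.

Lemma That_row3 z :
  (That z).2 = block3 That 2 1 z.1.2 + Dstar z.2.
Proof.
have -> : z = (z.1.1, 0, 0) + (0, z.1.2, 0) + (0, 0, z.2).
  by case: z => -[? ?] ?; congr (_, _, _); rewrite /= ?add0r ?addr0.
by rewrite !(bounded_opD That_bounded) That_inj1 -That_33 /= !add0r !addr0.
Qed.

(** The (3,1) entry of the commutation relation, read on basis vectors. The shift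
    by [b0] occurs on both sides and cancels. The vector [v] spans the range of
    the (3,2) entry of [That], so it does not depend on [X]. *)
Lemma Lhat_displacement : exists v : H, forall X, Lhat That X ->
  exists c : nat -> R[i], forall i j,
    hdot (X (e j.+1)) (e i) - b i * hdot (X (e j)) (e i) = c j * hdot v (e i).
Proof.
have [v rkF] := That_32; exists v => X [Q [Qb QT] <-].
have Fv j : exists c, block3 That 2 1 (Q (e j, 0, 0)).1.2 = c *: v.
  exact: rkF.
have [c Fc] := choice Fv.
exists c => i j.
have := congr1 (fun f => (f (e j, 0, 0)).2) QT.
rewrite /= That_inj1 That_row3 Fc /sub_scalar_op S_shift.2.
have -> : (e j.+1 - b0 *: e j, 0, 0) = (- b0) *: (e j, 0, 0) + (e j.+1, 0, 0)
    :> H * H * H.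
  by congr (_, _, _); rewrite /= ?scaler0 ?addr0// scaleNr addrC.
rewrite Qb.1 /= => /(congr1 (fun y => hdot y (e i))).
rewrite !hdotDl !hdotZl (hdot_diagonal_op _ _ e_basis Dstar_diagonal) => E.
rewrite /block3 /proj3 /inj3 /=.
apply/eqP; rewrite subr_eq; apply/eqP.
transitivity (c j * hdot v (e i) + (b i - b0) * hdot (Q (e j, 0, 0)).2 (e i)
  + b0 * hdot (Q (e j, 0, 0)).2 (e i)).
  by rewrite -E; ring.
by ring.
Qed.

(** Vanishing of the 2 x 2 minors of the displacements. Three consecutive columns
    of [X] give two consecutive columns of displacements, hence the bound on the
    columns that a cross-section of size 3 can test. *)
Lemma cross_section_minor r M : cross_section_mx e (Lhat That) r M ->
  forall i k : 'I_3,
  (M i 1 - b (r + i)%N * M i 0) * (M k 2 - b (r + k)%N * M k 1) =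
  (M i 2 - b (r + i)%N * M i 1) * (M k 1 - b (r + k)%N * M k 0).
Proof.
have [v vP] := Lhat_displacement => -[X /vP[c cP] XM] i k.
have entry l j := cross_section_entry l e_basis (XM j).
have E0 l : M l 1 - b (r + l)%N * M l 0 = c r * hdot v (e (r + l)%N).
  by rewrite -cP -!entry /= addn0 addn1.
have E1 l : M l 2 - b (r + l)%N * M l 1 = c r.+1 * hdot v (e (r + l)%N).
  by rewrite -cP -!entry -[r.+2]addn2 -[r.+1]addn1.
by rewrite !E0 !E1; ring.
Qed.

(** [Q_1] alone and [L_1] alone satisfy the minor identity: it is their sum that
    violates it, because in type (T1) the corner entry of the first row is not
    tied to the second row. *)
Lemma cross_section_not_T1 r (U : {vspace 'M[R[i]]_3}) :
  b r.+1 != 0 -> cross_section_mx e (Lhat That) r = [set M | M \in U] ->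
  ~ has_T1_basis (b r) (b r.+1) (b r.+2) U.
Proof.
move=> b1 LU [x [y [x0 _ basisU]]].
pose M := L1_mx x y + Q1_T1 : 'M[R[i]]_3.
have : cross_section_mx e (Lhat That) r M.
  by rewrite LU /= rpredD// (basis_mem basisU)// !inE eqxx ?orbT.
move/cross_section_minor/(_ 0 1); rewrite !mxE /= addn0 addn1 => /eqP.
rewrite !(addr0, add0r, mulr0, oppr0, mul1r).
by rewrite eq_sym oppr_eq0 mulf_eq0 (negPf b1) (negPf x0).
Qed.

End intertwining.

Theorem theorem5 (R : realType) (H1 H2 H : hilbertType R)
  (e : nat -> H) (S : H -> H)
  (A : H1 -> H1) (C : H2 -> H1) (B : H2 -> H2)
  (T Tadj : H1 * H2 -> H1 * H2)
  (b0 : R[i]) (b : nat -> R[i])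
  (That : H * H * H -> H * H * H) (Dstar : H -> H)
  (e_basis : orthonormal_basis e) (S_shift : is_unilateral_shift e S)
  (dim_H1 : aleph0_dim H1) (dim_H2 : aleph0_dim H2)
  (A_bounded : bounded_op A) (C_bounded : bounded_op C)
  (B_bounded : bounded_op B) (T_block : T = upper_block A C B)
  (A_similar : similar_op A S)
  (Tadj_adjoint : is_dsum_adjoint T Tadj)
  (Tadj_point_spectrum : point_spectrum Tadj = set0)
  (T_commutant_dense : forall x : H1, x != 0 ->
    dense [set Q (x, 0) | Q in commutant T])
  (b0_boundary : boundary (spectrum B) b0)
  (b_resolvent : forall k, resolvent B (b k))
  (b_cvg : (b : nat -> R[i]^o) @ \oo --> (b0 : R[i]^o))
  (b_distinct : injective b) (b_neq0 : forall k, b k != 0)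
  (Dstar_diagonal : is_diagonal_op e (fun k => b k - b0) Dstar)
  (That_bounded : bounded_op That)
  (That_similar : similar_op (sub_scalar_op T b0) That)
  (That_11 : block3 That 0 0 = sub_scalar_op S b0)
  (That_21 : block3 That 1 0 = 0) (That_31 : block3 That 2 0 = 0)
  (That_32 : rank_le1 (block3 That 2 1))
  (That_33 : block3 That 2 2 = Dstar)
  (Lhat_transitive : transitive_ops (Lhat That))
  (Lhat_normal : D_normal e b (Lhat That)) :
  forall r, delta_normal_T2 (b r) (b r.+1) (b r.+2)
    (cross_section_mx e (Lhat That) r).
Proof.
move=> r; have [U [LU dimU [T1|T2]]] := Lhat_normal r; last by exists U.
exfalso; apply: (cross_section_not_T1 e_basis S_shift Dstar_diagonal
  That_bounded That_11 That_21 That_31 That_32 That_33 (b_neq0 r.+1) LU T1).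
Qed.
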